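(* Let $\mathbf{S}$ be a primitive skew lattice with comparable $\mathcal D$-classes $A>B$. Then for all $a\in A$ and $b\in B$, $$a^{\downarrow^{*}}=(a\wedge B\wedge a)\cup\{a\}\quad\text{and}\quad b^{\uparrow^{*}}=(b\vee A\vee b)\cup\{b\}.$$
   Context: A skew lattice $\mathbf S=(S;\wedge,\vee)$ is a nonempty set $S$ with two associative binary operations satisfying $x\wedge(x\vee y)=x=(y\vee x)\wedge x$ and $x\vee(x\wedge y)=x=(y\wedge x)\vee x$ for all $x,y\in S$. The natural partial order is: $y\leq x$ iff $x\wedge y=y=y\wedge x$ (equivalently $x\vee y=x=y\vee x$). The relation $\mathcal D$ is: $x\mathrel{\mathcal D}y$ iff $x\wedge y\wedge x=x$ and $y\wedge x\wedge y=y$; it is a congruence and $\mathbf S/\mathcal D$ is a lattice. A primitive skew lattice is one consisting of exactly two $\mathcal D$-classes $A$ and $B$ with $A>B$ in $\mathbf S/\mathcal D$. A nonempty $I\subseteq S$ closed under $\vee$ is a skew ideal if $u\in S$, $v\in I$, $u\leq v$ imply $u\in I$; a nonempty $F\subseteq S$ closed under $\wedge$ is a skew filter if $u\in S$, $v\in F$, $u\geq v$ imply $u\in F$. The principal skew ideal $x^{\downarrow^{*}}$ is the intersection of all skew ideals containing $x$; the principal skew filter $x^{\uparrow^{*}}$ is the intersection of all skew filters containing $x$. Notation: $a\wedge B\wedge a=\{a\wedge b\wedge a: b\in B\}$ and $b\vee A\vee b=\{b\vee a\vee b: a\in A\}$. *)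

(* Defs.v *)
From HB Require Import structures.
From mathcomp Require Import all_boot.
From mathcomp Require Import boolp classical_sets.

Set Implicit Arguments.
Unset Strict Implicit.
Unset Printing Implicit Defensive.

Local Open Scope classical_set_scope.

HB.mixin Record isSkewLattice S := {
  skmeet : S -> S -> S;
  skjoin : S -> S -> S;
  skl_inhabited : inhabited S;
  skmeetA : associative skmeet;
  skjoinA : associative skjoin;
  skmeetKUl : forall x y, skmeet x (skjoin x y) = x;
  skmeetKUr : forall x y, skmeet (skjoin y x) x = x;
  skjoinKIl : forall x y, skjoin x (skmeet x y) = x;
  skjoinKIr : forall x y, skjoin (skmeet y x) x = x
}.

#[short(type="skewLatticeType")]
HB.structure Definition SkewLattice := {S of isSkewLattice S}.

Declare Scope skew_scope.
Delimit Scope skew_scope with skew.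
Notation "x ⊓ y" := (skmeet x y) (at level 40, left associativity) : skew_scope.
Notation "x ⊔ y" := (skjoin x y) (at level 40, left associativity) : skew_scope.
Local Open Scope skew_scope.

Section SkewLatticeDefs.
Variable S : skewLatticeType.
Implicit Types (x y u v : S) (A B I F : set S).

(* [natle y x] is the natural partial order y <= x. *)
Definition natle y x : Prop := x ⊓ y = y /\ y = y ⊓ x.

Definition Drel x y : Prop := x ⊓ y ⊓ x = x /\ y ⊓ x ⊓ y = y.

Definition Dclass x : set S := [set y | Drel x y].

(* The elements of S/D are represented as subsets of S. *)
Definition Dclasses : set (set S) := range Dclass.

(* The meet of S/D: for D-classes A and B, the class of a ⊓ b for any
   representatives a in A and b in B (D being a congruence, these classes all
   coincide, so no choice of representatives is needed). *)
Definition Dmeet A B : set S := \bigcup_(a in A) \bigcup_(b in B) Dclass (a ⊓ b).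

Definition Dlt B A : Prop := Dmeet B A = B /\ B <> A.

Definition primitive A B : Prop := Dclasses = [set A; B] /\ Dlt B A.

Definition skew_ideal I : Prop :=
  [/\ I !=set0,
      forall u v, I u -> I v -> I (u ⊔ v)
    & forall u v, I v -> natle u v -> I u].

Definition skew_filter F : Prop :=
  [/\ F !=set0,
      forall u v, F u -> F v -> F (u ⊓ v)
    & forall u v, F v -> natle v u -> F u].

Definition principal_skew_ideal x : set S :=
  \bigcap_(I in [set I | skew_ideal I /\ I x]) I.

Definition principal_skew_filter x : set S :=
  \bigcap_(F in [set F | skew_filter F /\ F x]) F.

End SkewLatticeDefs.

(* Main.v *)
(* In any skew lattice the elements below [x] are already closed under join, so
   the principal skew ideal of [x] is just its lower set, and dually for
   filters.  In the primitive case an element below [a] either lies in [B],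
   where [u <= a] gives [u = a ⊓ u ⊓ a], or is D-related to [a], in which case
   [a = a ⊓ u ⊓ a = u]. *)
Require Import Defs.
From mathcomp Require Import all_boot.
From mathcomp Require Import boolp classical_sets.

Local Open Scope classical_set_scope.
Local Open Scope skew_scope.

Section SkewLatticeTheory.
Variable S : skewLatticeType.
Implicit Types (x y z p q u v : S) (A B : set S).

(** Two absorptions: the right factor expands to [x ⊔ (x ⊓ x)], which the left factor absorbs. *)
Lemma skmeetxx x : x ⊓ x = x.
Proof. by rewrite -[X in _ ⊓ X](skjoinKIl x x) skmeetKUl. Qed.

Lemma skjoinxx x : x ⊔ x = x.
Proof. by rewrite -[X in _ ⊔ X](skmeetKUl x x) skjoinKIl. Qed.

Lemma natle_joinP y x : natle y x <-> x ⊔ y = x /\ y ⊔ x = x.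
Proof.
split=> [[xy yx]|[xy yx]]; split.
- by rewrite -xy skjoinKIl.
- by rewrite yx skjoinKIr.
- by rewrite -xy skmeetKUr.
- by rewrite -yx skmeetKUl.
Qed.

Lemma natle_refl x : natle x x.
Proof. by split; rewrite skmeetxx. Qed.

Lemma natle_trans y x z : natle x y -> natle y z -> natle x z.
Proof.
move=> [yx xy] [zy yz]; split; first by rewrite -yx skmeetA zy.
by rewrite xy -skmeetA -yz.
Qed.

Lemma natle_join u v x : natle u x -> natle v x -> natle (u ⊔ v) x.
Proof.
move=> /natle_joinP[xu ux] /natle_joinP[xv vx]; apply/natle_joinP.
by rewrite skjoinA xu xv -skjoinA vx ux.
Qed.

Lemma natle_meet u v x : natle x u -> natle x v -> natle x (u ⊓ v).
Proof.
move=> [ux xu] [vx xv]; split; first by rewrite -skmeetA vx ux.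
by rewrite skmeetA -xu -xv.
Qed.

(** Idempotency merges the repeated outer [x]. This puts every [a ⊓ y ⊓ a] into the principal ideal
    of [a]. *)
Lemma natle_sandwich_meet x y : natle (x ⊓ y ⊓ x) x.
Proof.
by split; [rewrite !skmeetA skmeetxx | rewrite -[RHS]skmeetA skmeetxx].
Qed.

Lemma natle_sandwich_join x y : natle x (x ⊔ y ⊔ x).
Proof.
apply/natle_joinP.
by split; [rewrite -[LHS]skjoinA skjoinxx | rewrite !skjoinA skjoinxx].
Qed.

Lemma sandwich_meet_natle u x : natle u x -> x ⊓ u ⊓ x = u.
Proof. by move=> [-> <-]. Qed.

Lemma sandwich_join_natle u x : natle x u -> x ⊔ u ⊔ x = u.
Proof. by move=> /natle_joinP[ux ->]. Qed.

Lemma principal_skew_idealE x : principal_skew_ideal x = [set u | natle u x].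
Proof.
apply/seteqP; split=> [u|u ux I [[_ _ Idown] Ix]]; last exact: Idown Ix ux.
(* The intersection is instantiated at the lower set of [x]; it remains to see that this is a skew
   ideal containing [x]. *)
apply; split; last exact: natle_refl.
split; first by exists x; exact: natle_refl.
- by move=> v w; exact: natle_join.
- by move=> v w wx vw; exact: natle_trans vw wx.
Qed.

Lemma principal_skew_filterE x : principal_skew_filter x = [set u | natle x u].
Proof.
apply/seteqP; split=> [u|u xu F [[_ _ Fup] Fx]]; last exact: Fup Fx xu.
apply; split; last exact: natle_refl.
split; first by exists x; exact: natle_refl.
- by move=> v w; exact: natle_meet.
- by move=> v w xw wv; exact: natle_trans xw wv.
Qed.

(* As [x ⊓ y ⊓ q = x], multiplying [x ⊓ y ⊓ (x ⊓ y) = x ⊓ y] by [q] on the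
   right gives the claim. *)
Lemma sandwich_factor p q x y : x = p ⊓ y ⊓ q -> x ⊓ y ⊓ x = x.
Proof.
move=> xE.
have xyq : x ⊓ y ⊓ q = x.
  by rewrite xE -(skmeetA p) -!skmeetA (skmeetA y q) skmeetxx.
by rewrite -{2}xyq skmeetA skmeetxx.
Qed.

Lemma Drel_sym x y : Drel x y -> Drel y x.
Proof. by case. Qed.

Lemma Drel_trans y x z : Drel x y -> Drel y z -> Drel x z.
Proof.
have half u v w : u ⊓ v ⊓ u = u -> v ⊓ w ⊓ v = v -> u ⊓ w ⊓ u = u.
  (* Expanding the middle [v] of [u = u ⊓ v ⊓ u] to [v ⊓ w ⊓ v] exhibits [w] as a factor of [u]. *)
  move=> uv vw; apply: (sandwich_factor (u ⊓ v) (v ⊓ u)).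
  by rewrite -[LHS]uv -[in LHS]vw !skmeetA.
by move=> [xy yx] [yz zy]; split; [exact: half xy yz | exact: half zy yx].
Qed.

Lemma Dclasses_Drel A x y : Dclasses A -> A x -> A y -> Drel x y.
Proof. by move=> [z _ <-] zx zy; exact: Drel_trans (Drel_sym _ _ zx) zy. Qed.

(** D-classes are antichains: [x ⊓ y ⊓ x] is [y] by the order and [x] by D. *)
Lemma natle_Drel_eq x y : natle y x -> Drel x y -> y = x.
Proof. by move=> /sandwich_meet_natle yx [xyx _]; rewrite -yx xyx. Qed.

(** The class of [u] is [A] or [B], and it contains [u] by idempotency. *)
Lemma Dclasses_pair_cover A B (AB : @Dclasses S = [set A; B]) u : A u \/ B u.
Proof.
have : [set A; B] (Dclass u) by rewrite -AB; exists u.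
have uu : Dclass u u by split; rewrite !skmeetxx.
by move=> [uA|uB]; [left; rewrite -uA | right; rewrite -uB].
Qed.

End SkewLatticeTheory.

Theorem proposition6p8 (S : skewLatticeType) (A B : set S)
    (hAB : primitive A B) (a b : S) (ha : A a) (hb : B b) :
  principal_skew_ideal a = [set a ⊓ y ⊓ a | y in B] `|` [set a] /\
  principal_skew_filter b = [set b ⊔ x ⊔ b | x in A] `|` [set b].
Proof.
case: hAB => AB _.
have DA : Dclasses A by rewrite AB; left.
have DB : Dclasses B by rewrite AB; right.
rewrite principal_skew_idealE principal_skew_filterE.
split; apply/seteqP; split=> u /=.
- move=> ua; have [Au|Bu] := Dclasses_pair_cover _ _ _ AB u.
    by right; apply: natle_Drel_eq ua _; exact: Dclasses_Drel DA ha Au.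
  by left; exists u => //; exact: sandwich_meet_natle.
- by move=> [[y _ <-]|->]; [exact: natle_sandwich_meet | exact: natle_refl].
(* The classes swap roles: now [u] in [A] is a join sandwich, and [u] in [B] lies above [b] in the
   same class, so equals [b]. *)
- move=> bu; have [Au|Bu] := Dclasses_pair_cover _ _ _ AB u.
    by left; exists u => //; exact: sandwich_join_natle.
  by right; apply/esym; apply: natle_Drel_eq bu _; exact: Dclasses_Drel DB Bu hb.
- by move=> [[x _ <-]|->]; [exact: natle_sandwich_join | exact: natle_refl].
Qed.
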